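(* Let $A,B\in M_n(\mathbb{C})$. Then $\det(I-sA-tB)=\det(I-sA)\det(I-tB)$ for all scalars $s,t\in\mathbb{C}$ if and only if, for all integers $p,q$ with $1\le p,q\le n$, $$\sum M(a_{i_1,\ldots,i_p})\;\sum M(b_{j_1,\ldots,j_q})=\sum M\begin{pmatrix}a_{i_1,\ldots,i_p}\\ b_{j_1,\ldots,j_q}\end{pmatrix}\qquad\text{when } p+q\le n,$$ and $$\sum M(a_{i_1,\ldots,i_p})\;\sum M(b_{j_1,\ldots,j_q})=0\qquad\text{when } p+q>n.$$
   Context: $M_n(\mathbb{C})$ is the set of $n\times n$ complex matrices and $I$ is the identity matrix. $M(a_{i_1,\ldots,i_p})$ denotes the $p\times p$ principal minor of $A$ with row and column index set $\{i_1,\ldots,i_p\}$, and $\sum M(a_{i_1,\ldots,i_p})$ is the sum of these over all $i_1<\cdots<i_p$ in $\{1,\ldots,n\}$; similarly $M(b_{j_1,\ldots,j_q})$ and $\sum M(b_{j_1,\ldots,j_q})$ for the $q\times q$ principal minors of $B$. For disjoint index sets $\{i_1,\ldots,i_p\}$ and $\{j_1,\ldots,j_q\}$ in $\{1,\ldots,n\}$ with $p+q\le n$, $M\begin{pmatrix}a_{i_1,\ldots,i_p}\\ b_{j_1,\ldots,j_q}\end{pmatrix}$ denotes the principal minor of order $p+q$ with row and column index set $K=\{i_1,\ldots,i_p\}\cup\{j_1,\ldots,j_q\}$ (arranged in increasing order) of the matrix whose $i$-th row is the $i$-th row of $A$ for $i\in\{i_1,\ldots,i_p\}$ and whose $j$-th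 row is the $j$-th row of $B$ for $j\in\{j_1,\ldots,j_q\}$. The sum $\sum M\begin{pmatrix}a_{i_1,\ldots,i_p}\\ b_{j_1,\ldots,j_q}\end{pmatrix}$ is over all pairs of disjoint index sets $\{i_1<\cdots<i_p\}$, $\{j_1<\cdots<j_q\}$ in $\{1,\ldots,n\}$ (all interleavings allowed). *)

(* Defs.v *)
From mathcomp Require Import all_boot all_order all_algebra.

Set Implicit Arguments.
Unset Strict Implicit.
Unset Printing Implicit Defensive.

Import GRing.Theory.
Local Open Scope ring_scope.

(* enum_val lists K in increasing order. *)
Definition pminor (C : comNzRingType) (n : nat) (A : 'M[C]_n)
    (K : {set 'I_n}) : C :=
  \det (\matrix_(i < #|K|, j < #|K|) A (enum_val i) (enum_val j)).

Definition sum_pminor (C : comNzRingType) (n : nat) (A : 'M[C]_n)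
    (p : nat) : C :=
  \sum_(P : {set 'I_n} | #|P| == p) pminor A P.

(* Row i is taken from A when i \in P and from B otherwise. The rows with
   index outside P :|: Q do not occur in the minor on P :|: Q. *)
Definition mixed_rows (C : comNzRingType) (n : nat) (A B : 'M[C]_n)
    (P : {set 'I_n}) : 'M[C]_n :=
  \matrix_(i, j) (if i \in P then A i j else B i j).

Definition mixed_pminor (C : comNzRingType) (n : nat) (A B : 'M[C]_n)
    (P Q : {set 'I_n}) : C :=
  pminor (mixed_rows A B P) (P :|: Q).

Definition sum_mixed_pminor (C : comNzRingType) (n : nat) (A B : 'M[C]_n)
    (p q : nat) : C :=
  \sum_(P : {set 'I_n} | #|P| == p)
    \sum_(Q : {set 'I_n} | (#|Q| == q) && [disjoint P & Q])
      mixed_pminor A B P Q.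

(* Main.v *)
Require Import Defs.
From mathcomp Require Import all_boot all_order all_algebra.
From mathcomp Require Import complex reals.

(* Multilinearity of the determinant in the rows gives
     det (I + a A + b B) = \sum_(p, q) a^p b^q S(p, q),
   where S(p, q) is the sum of the mixed minors. It vanishes for n < p + q,
   and S(p, 0), S(0, q) are the sums of principal minors of A and of B. Putting
   b = 0 or a = 0 expands the two factors, and the equivalence is a comparison
   of the coefficients of two polynomials in (a, b) = (- s, - t). *)

Set Implicit Arguments.
Unset Strict Implicit.
Unset Printing Implicit Defensive.

Import GRing.Theory.
Local Open Scope ring_scope.

Section MinorExpansion.

Variable C : comNzRingType.

(** Both products in [eqM] equal the block matrix with rows [1, - X] and [Y, 1]; taking determinants
    of the triangular factors gives Sylvester's identity. *)
Lemma det_1D_mulmxC m n (X : 'M[C]_(m, n)) (Y : 'M[C]_(n, m)) :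
  \det (1%:M + X *m Y) = \det (1%:M + Y *m X).
Proof.
have eqM : block_mx (1%:M + X *m Y) (- X) 0 1%:M *m block_mx 1%:M 0 Y 1%:M
   = block_mx 1%:M 0 Y 1%:M *m block_mx 1%:M (- X) 0 (1%:M + Y *m X).
  rewrite !mulmx_block !mul1mx !mulmx1 !mul0mx !mulmx0 !mulNmx !addr0 !add0r.
  by rewrite mulmxN addrK addrC addrK.
move/(congr1 determinant): eqM.
by rewrite !det_mulmx !det_ublock !det_lblock !det1 !mul1r !mulr1.
Qed.

Variable n : nat.
Implicit Types (A B M N : 'M[C]_n) (J P Q : {set 'I_n}).

(** Distributivity applied to each product of the Leibniz formula; [J] collects the rows taken from
    [M]. *)
Lemma det_addmx M N : \det (M + N) = \sum_J \det (mixed_rows M N J).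
Proof.
rewrite /determinant exchange_big /=; apply: eq_bigr => s _.
rewrite -mulr_sumr; congr (_ * _).
under eq_bigr => i _ do rewrite mxE.
rewrite bigA_distr; apply: eq_big => // J _.
by apply: eq_bigr => i _; rewrite mxE.
Qed.

(* With E the matrix of the inclusion of J, the left-hand matrix is
   1 + E^T (E (M - 1)) and the minor is the determinant of
   1 + (E (M - 1)) E^T = E M E^T. *)
Lemma det_mixed_rows1 M J : \det (mixed_rows M 1%:M J) = pminor M J.
Proof.
pose E : 'M[C]_(#|J|, n) := \matrix_(i, j) (enum_val i == j)%:R.
have EM p (X : 'M[C]_(n, p)) i j : (E *m X) i j = X (enum_val i) j.
  rewrite mxE (bigD1 (enum_val i)) //= mxE eqxx mul1r big1 ?addr0 // => k nk.
  by rewrite mxE eq_sym (negbTE nk) mul0r.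
have EE : E *m E^T = 1%:M.
  by apply/matrixP => i j; rewrite EM !mxE (inj_eq enum_val_inj) eq_sym.
have -> : mixed_rows M 1%:M J = 1%:M + E^T *m (E *m (M - 1%:M)).
  apply/matrixP => i j; rewrite [LHS]mxE [RHS]mxE [X in _ = _ + X]mxE.
  under eq_bigr => k _ do rewrite EM !mxE.
  case: ifP => iJ.
    rewrite (bigD1 (enum_rank_in iJ i)) //= enum_rankK_in // eqxx mul1r.
    rewrite big1 => [|k nk]; first by rewrite addr0 !mxE subrKC.
    case: eqP => [ki | _]; last by rewrite mul0r.
    by case/eqP: nk; apply: enum_val_inj; rewrite enum_rankK_in.
  rewrite big1 ?addr0 // => k _; case: eqP => [ki | _]; last by rewrite mul0r.
  by rewrite -ki enum_valP in iJ.
rewrite det_1D_mulmxC -mulmxA mulmxBl mul1mx mulmxBr EE addrC subrK.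
congr (\det _); apply/matrixP => i j; rewrite EM mxE [RHS]mxE.
rewrite (bigD1 (enum_val j)) //= !mxE eqxx mulr1 big1 ?addr0 // => k nk.
by rewrite !mxE eq_sym (negbTE nk) mulr0.
Qed.

(** Once the minor is written as an n by n determinant with identity rows outside [P :|: Q], scaling
    is left multiplication by a diagonal matrix. Disjointness keeps any row from receiving both
    factors. *)
Lemma mixed_pminor_scale a b A B P Q : [disjoint P & Q] ->
  mixed_pminor (a *: A) (b *: B) P Q
  = a ^+ #|P| * b ^+ #|Q| * mixed_pminor A B P Q.
Proof.
move=> dPQ; rewrite /mixed_pminor -!det_mixed_rows1.
pose d : 'rV[C]_n :=
  \row_i ((if i \in P then a else 1) * (if i \in Q then b else 1)).
have -> : mixed_rows (mixed_rows (a *: A) (b *: B) P) 1%:M (P :|: Q)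
  = diag_mx d *m mixed_rows (mixed_rows A B P) 1%:M (P :|: Q).
  apply/matrixP => i j; rewrite mul_diag_mx !mxE inE.
  have := disjointFr dPQ (x := i); case: (i \in P) => [-> //|_] /=.
    by rewrite mulr1.
  by case: (i \in Q); rewrite !mul1r.
rewrite det_mulmx det_diag; congr (_ * _).
under eq_bigr => i _ do rewrite mxE.
by rewrite big_split /= -!big_mkcond /= !prodr_const.
Qed.

(** Two successive row expansions: [P] collects the rows taken from [M], then [Q] those taken from
    [N], and the remaining rows are those of the identity. *)
Lemma det_1DD M N :
  \det (1%:M + M + N)
  = \sum_(P : {set 'I_n}) \sum_(Q : {set 'I_n} | [disjoint P & Q])
      mixed_pminor M N P Q.
Proof.
rewrite addrAC addrC det_addmx; apply: eq_bigr => P _.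
(* Rows in [P] get 0 as first summand, so in the second expansion any [Q] that meets [P] produces a
   zero row. *)
have -> : mixed_rows M (1%:M + N) P = mixed_rows 0 N P + mixed_rows M 1%:M P.
  by apply/matrixP => i j; rewrite !mxE; case: ifP; rewrite ?add0r 1?addrC.
rewrite det_addmx [RHS]big_mkcond /=; apply: eq_bigr => Q _.
case: ifPn => [dPQ | /pred0Pn[i /andP[/= iP iQ]]].
  rewrite /mixed_pminor -det_mixed_rows1; congr (\det _).
  apply/matrixP => i j; rewrite !mxE inE.
  by have := disjointFr dPQ (x := i); case: (i \in P) => [-> //|_].
rewrite (expand_det_row _ i) big1 // => j _.
by rewrite !mxE iP iQ mul0r.
Qed.

Lemma sum_by_card (D : pred {set 'I_n}) (F : {set 'I_n} -> C) :
  \sum_(P | D P) F P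
  = \sum_(p < n.+1) \sum_(P : {set 'I_n} | (#|P| == p) && D P) F P.
Proof.
have cardS (P : {set 'I_n}) : (#|P| < n.+1)%N.
  by have := max_card (mem P); rewrite card_ord.
rewrite (partition_big (fun P => Ordinal (cardS P)) xpredT) //=.
by apply: eq_bigr => p _; apply: eq_bigl => P; rewrite andbC.
Qed.

Lemma det_1DZDZ a b A B :
  \det (1%:M + a *: A + b *: B)
  = \sum_(p < n.+1) \sum_(q < n.+1) sum_mixed_pminor A B p q * b ^+ q * a ^+ p.
Proof.
rewrite det_1DD (sum_by_card xpredT); apply: eq_bigr => p _.
under eq_bigr => P _ do rewrite (sum_by_card (fun Q => [disjoint P & Q])).
rewrite exchange_big; apply: eq_bigr => q _.
rewrite /sum_mixed_pminor !mulr_suml.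
apply: eq_big => [P | P /andP[/eqP cP _]]; first by rewrite andbT.
rewrite !mulr_suml; apply: eq_bigr => Q /andP[/eqP cQ dPQ].
by rewrite mixed_pminor_scale // cP cQ mulrC mulrA mulrAC.
Qed.

Lemma sum_mixed_pminor0r A B p : sum_mixed_pminor A B p 0 = sum_pminor A p.
Proof.
apply: eq_bigr => P _; rewrite (big_pred1 set0) => [|Q /=]; last first.
  by rewrite cards_eq0; case: eqP => // ->; rewrite -setI_eq0 setI0 eqxx.
rewrite /mixed_pminor setU0; congr (\det _).
by apply/matrixP => i j; rewrite !mxE enum_valP.
Qed.

Lemma sum_mixed_pminor0l A B q : sum_mixed_pminor A B 0 q = sum_pminor B q.
Proof.
rewrite /sum_mixed_pminor (big_pred1 set0) => [|P]; last by rewrite cards_eq0.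
apply: eq_big => [Q | Q _]; first by rewrite -setI_eq0 set0I eqxx andbT.
rewrite /mixed_pminor set0U; congr (\det _).
by apply/matrixP => i j; rewrite !mxE inE.
Qed.

(** Disjoint sets of these sizes do not fit in ['I_n], so the sum is empty. This merges the two
    cases of the theorem into one identity. *)
Lemma sum_mixed_pminor_gt A B p q :
  (n < p + q)%N -> sum_mixed_pminor A B p q = 0.
Proof.
move=> lt_n_pq; apply: big1 => P /eqP cP; apply: big1 => Q /andP[/eqP cQ dPQ].
have := max_card (mem (P :|: Q)); rewrite cardsU disjoint_setI0 // cards0 subn0.
by rewrite cP cQ card_ord leqNgt lt_n_pq.
Qed.

Lemma sum_pminor0 A : sum_pminor A 0 = 1.
Proof.
rewrite /sum_pminor (big_pred1 set0) => [|P]; last by rewrite cards_eq0.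
rewrite -det_mixed_rows1 -[RHS](det1 _ n); congr (\det _).
by apply/matrixP => i j; rewrite mxE inE.
Qed.

End MinorExpansion.

Section PolynomialIdentity.

Variable F : numDomainType.

(** A nonzero polynomial of size at most [N] has fewer than [N] roots, whereas the naturals below
    [N] are [N] distinct roots in characteristic zero. *)
Lemma coef_eq0 N (c : nat -> F) :
  (forall a, \sum_(p < N) c p * a ^+ p = 0) ->
  forall p, (p < N)%N -> c p = 0.
Proof.
move=> c0 p ltpN; pose P := \poly_(i < N) c i.
suff /(congr1 (coefp p)) : P = 0 by rewrite /= coef_poly ltpN coef0.
apply/eqP; apply: contraTT isT => P0.
have := max_poly_roots P0 (rs := [seq k%:R | k <- iota 0 N]).
rewrite size_map size_iota map_inj_uniq ?iota_uniq.
  rewrite ltnNge size_poly; apply; last by [].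
  by apply/allP => a _; rewrite rootE horner_poly c0.
by move=> k l /eqP; rewrite Num.Theory.eqr_nat => /eqP.
Qed.

(** For fixed [b], comparing coefficients in [a] kills each inner sum, which is then a polynomial in
    [b]. *)
Lemma coef2_eq0 N (c : nat -> nat -> F) :
  (forall a b, \sum_(p < N) \sum_(q < N) c p q * b ^+ q * a ^+ p = 0) ->
  forall p q, (p < N)%N -> (q < N)%N -> c p q = 0.
Proof.
move=> c0 p q ltpN ltqN; apply: (coef_eq0 (c := c p)) ltqN => b.
apply: (coef_eq0 (c := fun p => \sum_(q < N) c p q * b ^+ q)) ltpN => a.
by rewrite -[RHS](c0 a b); apply: eq_bigr => k _; rewrite mulr_suml.
Qed.

End PolynomialIdentity.

Theorem proposition7 (R : realType) (n : nat) (A B : 'M[R[i]]_n) :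
  (forall s t : R[i],
     \det (1%:M - s *: A - t *: B) =
     \det (1%:M - s *: A) * \det (1%:M - t *: B))
  <->
  (forall p q : nat, (1 <= p <= n)%N -> (1 <= q <= n)%N ->
     ((p + q <= n)%N ->
        sum_pminor A p * sum_pminor B q = sum_mixed_pminor A B p q)
     /\
     ((n < p + q)%N ->
        sum_pminor A p * sum_pminor B q = 0)).
Proof.
pose S := sum_mixed_pminor A B.
have detAB a b : \det (1%:M - a *: A - b *: B)
    = \sum_(p < n.+1) \sum_(q < n.+1) S p q * (- b) ^+ q * (- a) ^+ p.
  by rewrite -!scaleNr det_1DZDZ.
have detA a : \det (1%:M - a *: A)
    = \sum_(p < n.+1) sum_pminor A p * (- a) ^+ p.
  have := detAB a 0; rewrite scale0r subr0 => ->; apply: eq_bigr => p _.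
  (* At [b = 0] only the term [q = 0] survives, with [0 ^+ 0 = 1]. *)
  rewrite big_ord_recl oppr0 expr0 mulr1 /S sum_mixed_pminor0r.
  rewrite big1 ?addr0 // => q _.
  by rewrite expr0n mulr0 mul0r.
have detB b : \det (1%:M - b *: B)
    = \sum_(q < n.+1) sum_pminor B q * (- b) ^+ q.
  have := detAB 0 b; rewrite scale0r subr0 => ->.
  rewrite big_ord_recl [X in _ + X]big1 ?addr0 => [|p _].
    by apply: eq_bigr => q _; rewrite oppr0 expr0 mulr1 /S sum_mixed_pminor0l.
  by apply: big1 => q _; rewrite oppr0 expr0n mulr0.
have detM a b : \det (1%:M - a *: A) * \det (1%:M - b *: B)
    = \sum_(p < n.+1) \sum_(q < n.+1)
        sum_pminor A p * sum_pminor B q * (- b) ^+ q * (- a) ^+ p.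
  rewrite detA detB mulr_suml; apply: eq_bigr => p _.
  rewrite mulr_sumr; apply: eq_bigr => q _.
  by rewrite mulrAC !mulrA.
split=> [detE p q /andP[_ lepn] /andP[_ leqn] | minorE s t].
  (* This identity covers both cases, since [S p q] vanishes for [n < p + q]. *)
  suff SE : sum_pminor A p * sum_pminor B q = S p q.
    by split=> // lt_n_pq; rewrite SE /S sum_mixed_pminor_gt.
  apply/eqP; rewrite -subr_eq0; apply/eqP.
  apply: (coef2_eq0 (c := fun p q => sum_pminor A p * sum_pminor B q - S p q)
    (N := n.+1)) => // a b.
  have := detE (- a) (- b); rewrite detM detAB => /esym/eqP.
  rewrite -subr_eq0 -sumrB => /eqP det0; rewrite -[RHS]det0.
  apply: eq_bigr => k _.
  by rewrite -sumrB; apply: eq_bigr => l _; rewrite !opprK !mulrBl.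
rewrite detAB detM; apply: eq_bigr => p _; apply: eq_bigr => q _.
congr (_ * _ * _); rewrite /S.
(* The hypothesis says nothing about [p = 0] or [q = 0]; there the coefficients agree because the
   empty minor is 1. *)
have [-> | p_gt0] := posnP p.
  by rewrite sum_mixed_pminor0l sum_pminor0 mul1r.
have [-> | q_gt0] := posnP q.
  by rewrite sum_mixed_pminor0r sum_pminor0 mulr1.
have p_in : (1 <= p <= n)%N by rewrite p_gt0 -ltnS ltn_ord.
have q_in : (1 <= q <= n)%N by rewrite q_gt0 -ltnS ltn_ord.
have [le_pq gt_pq] := minorE p q p_in q_in.
have [/le_pq -> // | lt_n_pq] := leqP (p + q) n.
by rewrite gt_pq // sum_mixed_pminor_gt.
Qed.
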